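(* Let $\kappa$ be an uncountable regular cardinal with $\kappa^{<\kappa}=\kappa$, and let $\mathbb{R}_\kappa$ be a $<\kappa$-closed version of $\kappa$-Mathias forcing with fusion. Then there is a $\mathbf{\Sigma}^1_1$ set that is not $\mathbb{R}_\kappa$-measurable.
   Context: The space $2^\kappa$ carries the topology generated by the sets $[s]=\{x\in2^\kappa:s\subset x\}$, $s\in2^{<\kappa}$ (similarly $\kappa^\kappa$). A set $X\subseteq 2^\kappa$ is $\mathbf{\Sigma}^1_1$ if it is the projection to $2^\kappa$ of a closed subset of $2^\kappa\times\kappa^\kappa$. Subsets of $\kappa$ are identified with their characteristic functions in $2^\kappa$. $\kappa$-Mathias forcing. A version of $\kappa$-Mathias forcing is given by a nonempty family $\mathcal{A}\subseteq[\kappa]^\kappa$ (the further requirement on the sets $A$; e.g. all club subsets of $\kappa$, or the members of a normal measure on $\kappa$). Conditions are pairs $(s,A)$ with $s\subset\kappa$, $|s|<\kappa$, $A\in\mathcal{A}$ and $\sup(s)<\min(A)$; the order is $(t,B)\le(s,A)$ iff $t\supseteq s$, $t$ end-extends $s$, $B\subseteq A$ and $t\setminus s\subseteq A$. The condition $(s,A)$ is identified with the tree $T_{(s,A)}\subseteq 2^{<\kappa}$ of all initial segments of characteristic functions of sets $x\subseteq\kappa$ such that $x$ end-extends $s$ and $x\setminus s\subseteq A$; $[T]=\{x\in2^\kappa:\forall\alpha<\kappa\,(x{\upharpoonright}\alpha\in T)\}$ is the set of branches of a tree $T$. The forcing is a tree-forcing: if $T\in\mathbb{R}_\kappa$ and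 $t\in T$, then $T_t=\{s\in T: s\subseteq t\vee t\subseteq s\}\in\mathbb{R}_\kappa$. It is required to be $<\kappa$-closed (every decreasing sequence of conditions of length $<\kappa$ has a lower bound) and to have fusion, i.e. there are partial orders $\{\le_\alpha:\alpha<\kappa\}$ on it with $\le_0=\le$, $\le_\beta\subseteq\le_\alpha$ for $\alpha<\beta$, and such that whenever $p_\beta\le_\alpha p_\alpha$ for all $\alpha<\beta<\kappa$ there is $q$ with $q\le_\alpha p_\alpha$ for all $\alpha<\kappa$. Tree-measurability. For a tree-forcing $\mathbb{P}$ and a set $X$ of $\kappa$-reals: $X$ is $\mathbb{P}$-open dense iff $\forall T\in\mathbb{P}\,\exists T'\le T\,([T']\subseteq X)$; the complement of a $\mathbb{P}$-open dense set is $\mathbb{P}$-nowhere dense; $X$ is $\mathbb{P}$-meager if it is covered by a union of at most $\kappa$ many $\mathbb{P}$-nowhere dense sets; $\mathcal{I}_{\mathbb{P}}$ is the ideal of $\mathbb{P}$-meager sets. $X$ is $\mathbb{P}$-measurable iff for every $T\in\mathbb{P}$ there is $T'\le T$ such that $[T']\cap X\in\mathcal{I}_{\mathbb{P}}$ or $[T']\setminus X\in\mathcal{I}_{\mathbb{P}}$. *)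

(* Defs.v *)
From HB Require Import structures.
From mathcomp Require Import all_boot all_order.
From mathcomp Require Import all_classical wochoice.
From mathcomp Require Import topology.

(* A cardinal kappa is represented by a totally
   ordered type K; the ordinals alpha < kappa are the elements of K, and alpha
   is identified with its initial segment {b | b < alpha}. *)

Set Implicit Arguments.
Unset Strict Implicit.
Unset Printing Implicit Defensive.

Import Order.TTheory.
Local Open Scope classical_set_scope.
Local Open Scope card_scope.
Local Open Scope order_scope.

Section Kappa.
Context {d : Order.disp_t} (K : orderType d).

Definition card_lt_kappa T (A : set T) : Prop := ~ ([set: K] #<= A).

(* K is a well-order isomorphic to an initial ordinal.  (The finite ordinals
   qualify too; they are excluded by uncountability below.) *)
Definition is_cardinal : Prop :=
  well_order (<=%O : rel K) /\ forall a : K, card_lt_kappa [set b | b < a].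

Definition is_uncountable : Prop := ~ countable [set: K].

(* The cofinality of kappa is kappa. *)
Definition is_regular : Prop :=
  forall A : set K, (forall a, exists2 b, A b & a <= b) -> A #= [set: K].

(* A^{<kappa}: functions from an ordinal alpha < kappa (the tag) to A. *)
Definition short_seq (A : Type) : Type := {a : K & {b : K | b < a} -> A}.

Definition kappa_lt_kappa_eq_kappa : Prop := [set: short_seq K] #= [set: K].

(* A^kappa, as an alias so that it carries the bounded topology rather than
   the product topology. *)
Definition kseq (A : Type) : Type := K -> A.

Definition restr A (x : kseq A) (a : K) : short_seq A :=
  existT (fun a => {b : K | b < a} -> A) a (fun b => x (sval b)).

Definition init_of A (s : short_seq A) (x : kseq A) : Prop :=
  forall b : {b : K | b < tag s}, x (sval b) = tagged s b.

Definition short_sub A (s t : short_seq A) : Prop :=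
  forall (b : K) (bs : b < tag s), exists bt : b < tag t,
    tagged s (exist _ b bs) = tagged t (exist _ b bt).

Definition cone A (s : short_seq A) : set (kseq A) := [set x | init_of s x].

HB.instance Definition _ A := gen_eqMixin (kseq A).
HB.instance Definition _ A := gen_choiceMixin (kseq A).
HB.instance Definition _ A :=
  isSubBaseTopological.Build (kseq A) (range (@cone A)) id.

Definition Sigma11 (X : set (kseq bool)) : Prop :=
  exists2 C : set (kseq bool * kseq K), closed C & X = fst @` C.

Definition branches (T : set (short_seq bool)) : set (kseq bool) :=
  [set x | forall a, T (restr x a)].

Definition tree_at (T : set (short_seq bool)) (t : short_seq bool) : set (short_seq bool) :=
  [set s | T s /\ (short_sub s t \/ short_sub t s)].

(* A forcing whose conditions p : P are identified with trees [tree p];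
   [le q p] reads "q is stronger than p". *)
Section TreeForcing.
Variables (P : Type) (le : P -> P -> Prop) (tree : P -> set (short_seq bool)).

Definition is_tree_forcing : Prop :=
  forall p t, tree p t -> exists q, tree q = tree_at (tree p) t.

(* Decreasing sequences of length a < kappa; the values of f at and above a
   are ignored. *)
Definition lt_kappa_closed : Prop :=
  forall (a : K) (f : K -> P),
    (forall b c, b < c -> c < a -> le (f c) (f b)) ->
    exists q, forall b, b < a -> le q (f b).

Definition is_partial_order (R : P -> P -> Prop) : Prop :=
  [/\ forall p, R p p,
      forall p q r, R p q -> R q r -> R p r &
      forall p q, R p q -> R q p -> p = q].

Definition has_fusion : Prop :=
  exists R : K -> P -> P -> Prop,
    [/\ forall a, is_partial_order (R a),
        forall z : K, (forall a, z <= a) -> forall p q, R z p q <-> le p q,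
        forall a b, a < b -> forall p q, R b p q -> R a p q &
        forall f : K -> P, (forall a b, a < b -> R a (f b) (f a)) ->
          exists q, forall a, R a q (f a)].

Definition open_dense (X : set (kseq bool)) : Prop :=
  forall p, exists2 q, le q p & branches (tree q) `<=` X.

Definition nowhere_dense (X : set (kseq bool)) : Prop := open_dense (~` X).

Definition meager (X : set (kseq bool)) : Prop :=
  exists N : set (set (kseq bool)),
    [/\ N #<= [set: K], N `<=` nowhere_dense & X `<=` \bigcup_(Y in N) Y].

Definition tree_measurable (X : set (kseq bool)) : Prop :=
  forall p, exists2 q, le q p &
    meager (branches (tree q) `&` X) \/ meager (branches (tree q) `\` X).

End TreeForcing.

Definition end_extends (t s : set K) : Prop :=
  s `<=` t /\ forall a b, s a -> (t `\` s) b -> a < b.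

(* "sup s < min A" is read as "every element of s is below every element of A".
   The two agree when s has a maximum.  For s of limit order type min A = sup s
   is allowed: this is needed for the trees T_t, with t a node whose length is
   a limit point of A lying in A, to be (trees of) conditions, for instance
   when A ranges over club sets or over a normal measure. *)
Definition mathias_cond (AA : set (set K)) (p : set K * set K) : Prop :=
  [/\ card_lt_kappa p.1, AA p.2 & forall a b, p.1 a -> p.2 b -> a < b].

Definition mathias (AA : set (set K)) : Type :=
  {p : set K * set K | mathias_cond AA p}.

Definition mathias_le AA (q p : mathias AA) : Prop :=
  let: (t, B) := sval q in let: (s, A) := sval p in
  [/\ end_extends t s, B `<=` A & t `\` s `<=` A].

Definition mathias_tree AA (p : mathias AA) : set (short_seq bool) :=
  let: (s, A) := sval p in
  [set u | exists x : kseq bool,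
    let X := [set a | x a] in
    [/\ end_extends X s, X `\` s `<=` A & init_of u x]].

(* AA determines a version of kappa-Mathias forcing: a nonempty family of
   subsets of kappa of size kappa whose associated forcing is a tree forcing. *)
Definition mathias_version (AA : set (set K)) : Prop :=
  [/\ AA !=set0, (forall A, AA A -> A #= [set: K]) &
      is_tree_forcing (@mathias_tree AA)].

End Kappa.

(* Main.v *)
Require Import Defs.
From HB Require Import structures.
From mathcomp Require Import all_boot all_order finmap.
From mathcomp Require Import all_classical.
From mathcomp Require Import topology.

(* Colour the subsets of kappa so that adding one element always changes the
   colour.  Colour x at a by the colour of x cut at the least dl for which x
   has infinitely many elements in [a, dl).  The set of all x that have colour
   1 at every point of some club is boldface Sigma^1_1, a normal function
   enumerating the club being the witness.  Below any condition q and for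
   either colour i, a decreasing kappa-sequence of conditions yields a branch
   of q with colour i on a club, avoiding kappa many given nowhere dense sets:
   at each step, an infinite block of the reservoir, possibly without one
   element, is moved to the stem to produce the colour i.  As two clubs meet,
   neither the set nor its complement is meager inside [q].  At limit steps
   <kappa-closure gives a lower bound whose stem may be too long; it is cut
   back to the union of the earlier stems. *)

Set Implicit Arguments.
Unset Strict Implicit.
Unset Printing Implicit Defensive.

Import Order.TTheory.
Local Open Scope order_scope.
Local Open Scope card_scope.
Local Open Scope classical_set_scope.

(* The colour of [S] is the parity of its difference from a chosen
   representative of its class modulo finite sets. *)
Lemma exists_flipping (T : choiceType) :
  exists c : set T -> bool, forall S a, ~ S a -> c (a |` S) = ~~ c S.
Proof.
pose D (S R : set T) := (S `\` R) `|` (R `\` S).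
pose rep S := xget set0 [set R | finite_set (D S R)].
have DE S a R : ~ S a -> finite_set (D S R) -> finite_set (D (a |` S) R) /\
   odd #|` fset_set (D (a |` S) R)| = ~~ odd #|` fset_set (D S R)|.
  move=> nSa fD.
  have [Ra|nRa] := pselect (R a).
    have DE : D S R = a |` D (a |` S) R.
      apply/seteqP; split => t; rewrite /D /=.
        by have [->|] := pselect (t = a); tauto.
      by have [->|] := pselect (t = a); tauto.
    have f1 : finite_set (D (a |` S) R).
      by apply: sub_finite_set fD; rewrite DE; apply: subsetUr.
    split=> //; rewrite DE fset_setU1// cardfsU1 in_fset_set//.
    rewrite memNset; last by rewrite /D /=; tauto.
    by rewrite /= negbK.
  have DE : D (a |` S) R = a |` D S R.
    apply/seteqP; split => t; rewrite /D /=.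
      by have [->|] := pselect (t = a); tauto.
    by have [->|] := pselect (t = a); tauto.
  split; first by rewrite DE finite_setU; split.
  rewrite DE fset_setU1// cardfsU1 in_fset_set//.
  rewrite memNset; last by rewrite /D /=; tauto.
  by [].
exists (fun S => odd #|` fset_set (D S (rep S))|) => S a nSa.
have frep : finite_set (D S (rep S)).
  rewrite /rep; apply: (@xgetPex _ set0 [set R | finite_set (D S R)]).
  by exists S; rewrite /D /= setDv setU0.
(* Adding one element keeps the class modulo finite sets, hence the representative, so only the
   parity changes. *)
have -> : rep (a |` S) = rep S.
  rewrite /rep; congr xget; apply/seteqP; split=> R /= fR; last first.
    by have [] := DE S a R nSa fR.
  apply: (@sub_finite_set _ _ (a |` D (a |` S) R)); last first.
    by rewrite finite_setU; split.
  move=> t; rewrite /D /=.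
  by have [->|] := pselect (t = a); tauto.
by have [] := DE S a _ nSa frep.
Qed.

(** * Induction, suprema and recursion along a well-order *)

Section WellOrder.
Context {d : Order.disp_t} {K : orderType d}.
Hypothesis Kwo : wochoice.well_order (<=%O : rel K).

Lemma wo_min (A : set K) : A !=set0 -> exists2 m, A m & forall a, A a -> m <= a.
Proof.
move=> [a Aa]; have [|m [[Am mA] _]] := Kwo (A := [pred x | `[< A x >]]).
  by exists a; apply/asboolP.
exists m; first exact/asboolP.
by move=> b Ab; apply: mA; apply/asboolP.
Qed.

Lemma wo_ind (P : K -> Prop) : (forall a, (forall b, b < a -> P b) -> P a) ->
  forall a, P a.
Proof.
move=> Pind; apply: contrapT => /existsNP[a nPa].
have [m nPm mP] := @wo_min [set a | ~ P a] (ex_intro _ a nPa).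
apply: nPm; apply: Pind => b bm; apply: contrapT => /mP.
by rewrite leNgt bm.
Qed.

Lemma lt_well_founded : well_founded (fun a b : K => a < b).
Proof. by elim/wo_ind => a IH; constructor => b /IH. Qed.

Lemma wo_lub (A : set K) : (exists b, forall a, A a -> a <= b) ->
  exists2 m, (forall a, A a -> a <= m) &
             forall b, (forall a, A a -> a <= b) -> m <= b.
Proof. exact: (@wo_min [set b | forall a, A a -> a <= b]). Qed.

Lemma increasing_ge_id (h : K -> K) : (forall a b, a < b -> h a < h b) ->
  forall a, a <= h a.
Proof.
move=> hmono; elim/wo_ind => a IH; rewrite leNgt; apply/negP => ha.
by have := IH _ ha; rewrite leNgt hmono.
Qed.

(** Recursion in which a next value is only known to exist when all earlier values were well chosen.
    The default [t0] fills the history at and above [a], which [P a] ignores. *)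
Lemma transfinite_choice (T : Type) (P : K -> (K -> T) -> T -> Prop) :
  T ->
  (forall a g g' z, (forall b, b < a -> g b = g' b) -> P a g z -> P a g' z) ->
  (forall a g, (forall b, b < a -> P b g (g b)) -> exists z, P a g z) ->
  exists g, forall a, P a g (g a).
Proof.
move=> t0 Ploc Pex.
pose ext (a : K) (g : forall b : K, b < a -> T) b :=
  if pselect (b < a) is left ba then g b ba else t0.
pose F (a : K) (g : forall b : K, b < a -> T) : T :=
  if pselect (exists z, P a (ext a g) z) is left e then sval (cid e) else t0.
pose g (a : K) : T := Fix lt_well_founded (fun _ => T) F a.
have gE a : g a = F a (fun b _ => g b).
  rewrite /g Fix_eq// => {}a f f' ff'; congr F.
  by apply: functional_extensionality_dep => b; apply: funext => ba.
exists g; elim/wo_ind => a IH.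
have [z Pz] := Pex a g IH.
have Eext b : b < a -> g b = ext a (fun b _ => g b) b.
  by move=> ba; rewrite /ext; case: pselect.
rewrite gE /F; case: pselect => [e|[]]; last by exists z; apply: Ploc Pz.
by case: cid => y /= Py; apply: Ploc Py => b /Eext.
Qed.

End WellOrder.

(** * Bounded sets and normal functions on a regular uncountable cardinal *)

Section Cardinal.
Context {d : Order.disp_t} {K : orderType d}.
Hypotheses (Kcard : is_cardinal K) (Kunc : is_uncountable K)
  (Kreg : is_regular K).

Lemma card_lt_bounded (A : set K) : card_lt_kappa K A ->
  exists b, forall a, A a -> a < b.
Proof.
move=> ltA; apply: contrapT => /forallNP nb; apply: ltA.
have /Kreg : forall a, exists2 b, A b & a <= b.
  move=> a; have /existsNP[b /not_implyP[Ab /negP]] := nb a.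
  by rewrite -leNgt; exists b.
by move/card_esym; rewrite card_eq_le => /andP[].
Qed.

Lemma bounded_card_lt (A : set K) b : (forall a, A a -> a < b) ->
  card_lt_kappa K A.
Proof.
move=> Ab KA; apply: (Kcard.2 b); apply: card_le_trans KA _.
exact: subset_card_le.
Qed.

Lemma countable_bounded (A : set K) : countable A ->
  exists b, forall a, A a -> a < b.
Proof. by move=> cA; apply: card_lt_bounded => /card_le_trans/(_ cA). Qed.

Lemma exists_gt (a : K) : exists b, a < b.
Proof.
have [b ab] := countable_bounded (countable1 a).
by exists b; apply: ab.
Qed.

Lemma image_below_bounded (f : K -> K) a : exists b, forall c, c < a -> f c < b.
Proof.
have [|b fb] := @card_lt_bounded (f @` [set c | c < a]).
  by move=> /card_le_trans/(_ (card_image_le _ _)); apply: Kcard.2.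
by exists b => c ca; apply: fb; exists c.
Qed.

(** A countably infinite subset of [A] is bounded, so some initial segment of [A] is infinite; [dl]
    is the least bound of one. *)
Lemma infinite_block (A : set K) : [set: K] #<= A ->
  exists dl, infinite_set (A `&` [set b | b < dl]) /\
    forall g, g < dl -> finite_set (A `&` [set b | b < g]).
Proof.
move=> KA; have iA : infinite_set A.
  by move=> /(card_le_finite KA)/finite_set_countable.
have [a0 Aa0] := infinite_setN0 iA.
pose U : pointedType := HB.pack (Order.Total.sort K) (isPointed.Build _ a0).
have /infiniteP/(@pcard_leP _ U)[f] := iA.
have fA n : A (f n) by apply: funS.
have finj : injective f by move=> m n; apply: inj; rewrite in_setT.
have [|e fe] := @countable_bounded (range f).
  by apply: card_le_trans (card_image_le _ _) _; apply: card_lexx.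
have [|dl Adl dlmin] := @wo_min _ _ Kcard.1
    [set dl | infinite_set (A `&` [set b | b < dl])].
  exists e; apply: (@sub_infinite_set _ (range f)).
    by move=> _ [n _ <-]; split; [exact: fA|apply: fe; exists n].
  move=> frange; apply: infinite_nat.
  have -> : [set: nat] = f @^-1` range f.
    by apply/seteqP; split => // n _; exists n.
  by apply: finite_preimage frange => m n _ _; apply: finj.
exists dl; split=> // g gdl; apply: contrapT => /dlmin.
by rewrite leNgt gdl.
Qed.

Definition limit (l : K) := (exists b, b < l) /\
  forall b, b < l -> exists2 c, b < c & c < l.

(** For regular uncountable kappa the ranges of these functions are exactly the clubs, so an element
    of kappa^kappa can code a club. *)
Definition normal (h : K -> K) := (forall a b, a < b -> h a < h b) /\
  forall l, limit l -> forall a, a < h l -> exists2 b, b < l & a < h b.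

(** The supremum of omega iterations of a function dominating both is a fixed point of each. *)
Lemma normal_common_value (h h' : K -> K) : normal h -> normal h' ->
  exists l, h l = h' l.
Proof.
move=> nh nh'.
have [a0 _] : exists a0 : K, True.
  apply: contrapT => /forallNP K0; apply: Kunc.
  suff -> : [set: K] = set0 by apply: countable0.
  by apply/seteqP; split => a // _; apply: (K0 a).
have /choice[g gP] : forall a, exists b, [/\ a < b, h a < b & h' a < b].
  move=> a; have [|b] := @countable_bounded [set a; h a; h' a].
    by apply: finite_set_countable; rewrite !finite_setU; do !split.
  by move=> bP; exists b; split; apply: bP; rewrite /=; tauto.
have [|l lub lmin] := @wo_lub _ _ Kcard.1 (range (fun n => iter n g a0)).
- have [|b bP] := @countable_bounded (range (fun n => iter n g a0)).
    by apply: card_le_trans (card_image_le _ _) _; apply: card_lexx.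
  by exists b => a /bP/ltW.
have itl n : iter n g a0 < l.
  apply: lt_le_trans (lub _ (imageT _ n.+1)).
  by rewrite iterS; have [] := gP (iter n g a0).
have below b : b < l -> exists n, b < iter n g a0.
  move=> bl; apply: contrapT => /forallNP nb.
  suff : l <= b by rewrite leNgt bl.
  by apply: lmin => _ [n _ <-]; rewrite leNgt; apply/negP/nb.
have liml : limit l.
  split; first by exists a0; apply: (itl 0%N).
  by move=> b /below[n bn]; exists (iter n g a0).
have fixl f : normal f -> (forall a, f a < g a) -> f l = l.
  move=> [fmono fcont] fg; apply/le_anti/andP; split; last first.
    exact: (increasing_ge_id Kcard.1 fmono).
  rewrite leNgt; apply/negP => /(fcont _ liml)[b /below[n bn] lfb].
  have := lt_trans lfb (lt_trans (fmono _ _ bn) (lt_trans (fg _) (itl n.+1))).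
  by rewrite ltxx.
by exists l; rewrite !fixl// => a; have [] := gP a.
Qed.

End Cardinal.

(** * The coloured sets and their complexity *)

Section Colour.
Context {d : Order.disp_t} {K : orderType d} (c : set K -> bool).

(* [x] acquires its first infinitely many elements above [a] exactly at
   [dl <= b], and [c] gives the colour [i] to [x] cut at [dl]. *)
Definition colour_at (x : kseq K bool) (a b : K) (i : bool) : Prop :=
  exists dl, [/\ dl <= b,
    infinite_set [set e | x e /\ a <= e < dl],
    forall g, g < dl -> finite_set [set e | x e /\ a <= e < g] &
    c [set e | x e /\ e < dl] = i].

Lemma colour_at_unique x a b b' i i' :
  colour_at x a b i -> colour_at x a b' i' -> i = i'.
Proof.
move=> [dl [_ inf fin ci]] [dl' [_ inf' fin' ci']].
rewrite -ci -ci'; case: (ltgtP dl dl') => [/fin'/inf//|/fin/inf'//|->//].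
Qed.

(** The clause [dl <= b] is what makes the colour a matter of [x] below [b]; closedness of the
    witnessing relation rests on this. *)
Lemma colour_at_local x x' a b i : (forall e, e < b -> x e = x' e) ->
  colour_at x a b i -> colour_at x' a b i.
Proof.
move=> xx' [dl [dlb inf fin ci]].
have E g : g <= dl ->
    [set e | x e /\ a <= e < g] = [set e | x' e /\ a <= e < g].
  move=> gdl; apply/seteqP; split => e /= [xe /andP[ae eg]].
    by rewrite -xx' ?ae//; apply: lt_le_trans eg (le_trans gdl dlb).
  by rewrite xx' ?ae//; apply: lt_le_trans eg (le_trans gdl dlb).
exists dl; split=> //; first by rewrite -E.
  by move=> g gdl; rewrite -E ?ltW//; apply: fin.
rewrite -ci; congr c; apply/seteqP; split => e /= [xe edl].
  by rewrite xx'//; apply: lt_le_trans edl dlb.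
by rewrite -xx'//; apply: lt_le_trans edl dlb.
Qed.

(** Having the colour at [h a] decided by every later [h b] is no loss when kappa is regular and
    uncountable: thin the club to closure points of the map from [a] to [dl]. *)
Definition normal_coloured (x : kseq K bool) (h : kseq K K) (i : bool) :=
  normal h /\ forall a b, a < b -> colour_at x (h a) (h b) i.

Definition coloured (i : bool) : set (kseq K bool) :=
  [set x | exists h, normal_coloured x h i].

Lemma nbhs_restr (A : Type) (x : kseq K A) (a : K) :
  nbhs x (cone (restr x a)).
Proof.
apply: open_nbhs_nbhs; split; last by [].
exists [set cone (restr x a)].
  move=> _ ->; exists [fset cone (restr x a)]%fset.
    by move=> _ /fset1P ->; rewrite inE; exists (restr x a).
  apply/seteqP; split => y /=.
    by move/(_ (cone (restr x a))); apply; rewrite /= inE.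
  by move=> xy _ /fset1P ->.
by apply/seteqP; split => y /=; [move=> [_ ->]|exists (cone (restr x a))].
Qed.

Lemma Sigma11_coloured : (forall a : K, exists b, a < b) ->
  Sigma11 (coloured true).
Proof.
move=> Kgt.
exists [set xh | normal_coloured xh.1 xh.2 true]; last first.
  by apply/seteqP; split => [x [h xh]|_ [[x h] xh <-]];
    [exists (x, h)|exists h].
rewrite -[X in closed X]setCK; apply: open_closedC.
(* The requirements are sorted by their largest argument [b]: those at [b] involve only [h] up to
   [b] and [x] below [h b], so a failure persists on a basic open set. *)
pose Q (x : kseq K bool) (h : kseq K K) b :=
  (forall a, a < b -> h a < h b /\ colour_at x (h a) (h b) true) /\
  (limit b -> forall a, a < h b -> exists2 e, e < b & a < h e).
have QP x h : (forall b, Q x h b) <-> normal_coloured x h true.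
  split=> [Qxh|[[mono cont] col] b].
    split; last by move=> a b ab; have [/(_ _ ab)[]] := Qxh b.
    by split=> [a b ab|b]; [have [/(_ _ ab)[]] := Qxh b|have [] := Qxh b].
  by split; [move=> a ab; split; [exact: mono|exact: col]|exact: cont].
have Qlocal x h x' h' b : (forall e, e <= b -> h e = h' e) ->
    (forall e, e < h b -> x e = x' e) -> Q x h b -> Q x' h' b.
  move=> hh' xx' [mono cont]; split.
    move=> a ab; rewrite -!hh' ?(ltW ab)//.
    by have [? col] := mono a ab; split=> //; apply: colour_at_local col.
  move=> lb a; rewrite -hh'// => /(cont lb)[e eb ae].
  by exists e => //; rewrite -hh'// ltW.
rewrite openE => -[x h] /= nxh.
have /existsNP[b nQ] : ~ forall b, Q x h b by move=> /QP.
(* [restr h b'] records only values strictly below [b'], and [h b] must be among them. *)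
have [b' bb'] := Kgt b.
exists (cone (restr x (h b)), cone (restr h b')) => /=.
  by split; apply: nbhs_restr.
move=> [x' h'] /= [xx' hh'] /QP/(_ b) Q'; apply: nQ; apply: Qlocal Q'.
  move=> e eb; exact: (hh' (exist _ e (le_lt_trans eb bb'))).
move=> e; have -> : h' b = h b by exact: (hh' (exist _ b bb')).
by move=> eb; exact: (xx' (exist _ e eb)).
Qed.

End Colour.

(** * Mathias conditions, their branches and trimming *)

Section Mathias.
Context {d : Order.disp_t} {K : orderType d} (AA : set (set K)).
Hypotheses (Kcard : is_cardinal K) (Kunc : is_uncountable K)
  (Kreg : is_regular K) (AAv : mathias_version AA)
  (AAclosed : lt_kappa_closed K (@mathias_le d K AA)).
Notation P := (mathias AA).
Notation le := (@mathias_le d K AA).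
Notation tree := (@mathias_tree d K AA).

Definition stem (p : P) := (sval p).1.
Definition reservoir (p : P) := (sval p).2.

(** End-extension comes for free: new elements lie in the old reservoir, which is above the old
    stem. *)
Lemma mathias_leP (q p : P) : le q p <->
  [/\ stem p `<=` stem q, reservoir q `<=` reservoir p &
      stem q `\` stem p `<=` reservoir p].
Proof.
rewrite /stem /reservoir; case: q p => [[t B] ?] [[s A] [? ? sA]].
rewrite /mathias_le /=; split=> [[[st _] BA tsA]|[st BA tsA]] //.
by split=> //; split=> // a b sa /tsA; apply: sA.
Qed.

Lemma mathias_le_refl (p : P) : le p p.
Proof. by apply/mathias_leP; split=> // a [? []]. Qed.

Lemma mathias_le_trans (q p r : P) : le p q -> le q r -> le p r.
Proof.
move=> /mathias_leP[qp pq pqq] /mathias_leP[rq qr qrr].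
apply/mathias_leP; split; [exact: subset_trans rq qp|exact: subset_trans qr|].
move=> a [pa nra]; have [qa|nqa] := pselect (stem q a); first exact: qrr.
by apply: qr; apply: pqq.
Qed.

Definition body (p : P) : set (kseq K bool) :=
  [set x | (forall a, stem p a -> x a) /\
           forall a, x a -> stem p a \/ reservoir p a].

Lemma body_branches p : body p `<=` branches (tree p).
Proof.
case: p => [[s A] [? ? sA]] x; rewrite /body /stem /reservoir /= => -[sx xA] a.
have xsA : [set a | x a] `\` s `<=` A by move=> b [/xA[]].
by exists x; split=> //; split=> // e b se xb; apply: sA => //; apply: xsA.
Qed.

(* Any condition whose tree consists of the nodes comparable with a sequence of
   zeros of length [dl] has its reservoir above [dl]. *)
Lemma trim (A : set K) (dl : K) : AA A ->
  exists2 B, AA B & B `<=` A `&` [set b | dl <= b].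
Proof.
move=> AAA.
have c0 : mathias_cond AA (set0, A).
  split=> //=; apply: (bounded_card_lt Kcard (b := dl)) => a [].
have [_ _ istree] := AAv.
have [|[[t B] cB] /= qE] := istree (exist _ _ c0 : P) (restr (fun=> false) dl).
  by exists (fun=> false); split=> //; [split=> // a b []|move=> a []].
have [_ AAB tB] := cB; exists B => // b Bb.
(* Adding [b] to the stem gives a branch of [(t, B)]. Its node of length [a > b] lies in the tree of
   [(set0, A)], so [A b]; it is comparable with the zero sequence, so [b] is not below [dl]. *)
pose x : kseq K bool := fun a => `[< t a \/ a = b >].
have [a ab] : exists2 a, b < a & True.
  by have [a] := exists_gt Kunc Kreg b; exists a.
have xb : x b by apply/asboolP; right.
have : body (exist _ _ cB) x.
  split=> e /= te; first by apply/asboolP; left.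
  by case/asboolP: te => [|->]; [left|right].
move=> /body_branches/(_ a); rewrite qE => -[[y [_ yA xy]] sub] _.
split.
  by apply: yA; split=> //; rewrite /= (xy (exist _ b ab)).
rewrite /= leNgt; apply/negP => bdl.
by case: sub => [/(_ b ab)[? /=]|/(_ b bdl)[? /=]]; rewrite xb.
Qed.

(** The strict and weak bounds survive limits: a supremum of separating points still separates the
    cut-back stem from the reservoir. *)
Definition tight (q : P) (a : K) : Prop :=
  (forall b, stem q b -> b < a) /\ (forall b, reservoir q b -> a <= b).

Lemma tight_cond (s A : set K) (a : K) : AA A -> (forall b, s b -> b < a) ->
  (forall b, A b -> a <= b) ->
  exists2 q : P, stem q = s /\ reservoir q = A & tight q a.
Proof.
move=> AAA sa aA.
have c : mathias_cond AA (s, A).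
  split=> //=; first exact: (bounded_card_lt Kcard sa).
  by move=> b e /sa ba /aA; apply: lt_le_trans.
by exists (exist _ _ c).
Qed.

Lemma reservoirP (q : P) : AA (reservoir q).
Proof. by have [] := svalP q. Qed.

Lemma stem_bounded (q : P) : exists b, forall a, stem q a -> a < b.
Proof. by apply: (card_lt_bounded Kreg); have [] := svalP q. Qed.

Lemma tighten (q : P) (a : K) : (forall b, stem q b -> b < a) ->
  exists2 q', le q' q & tight q' a.
Proof.
move=> qa; have [B AAB BA] := trim a (reservoirP q).
have [|q' [q's q'B] tq'] := tight_cond AAB qa; first by move=> b /BA[].
exists q' => //; apply/mathias_leP; rewrite q's q'B; split=> //.
  by move=> b /BA[].
by move=> b [? []].
Qed.

Lemma body_le (q p : P) : le q p -> body q `<=` body p.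
Proof.
move=> /mathias_leP[pq qp qpp] x [qx xq]; split; first by move=> a /pq/qx.
move=> a xa; have [|npa] := pselect (stem p a); first by left.
by right; case: (xq _ xa) => [qa|/qp//]; apply: qpp.
Qed.

(** * Construction of branches of a prescribed colour *)

Section Colouring.
Variable c : set K -> bool.
Hypothesis cflip : forall S a, ~ S a -> c (a |` S) = ~~ c S.

Lemma extend_colour (q : P) (a : K) (i : bool) : tight q a ->
  exists q' b, [/\ le q' q, a < b, tight q' b &
    forall x, body q' x -> colour_at c x a b i].
Proof.
move=> [qa aq].
have Kres : [set: K] #<= reservoir q.
  have [_ /(_ _ (reservoirP q))/card_esym + _] := AAv.
  by rewrite card_eq_le => /andP[].
have [dl [inf fin]] := infinite_block Kcard Kunc Kreg Kres.
pose D0 := reservoir q `&` [set b | b < dl].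
have [e D0e] := infinite_setN0 inf.
(* If the whole block gives the wrong colour, omitting the single element [e] flips it and keeps the
   block infinite. *)
have [D [DD0 infD cD]] : exists D, [/\ D `<=` D0, infinite_set D &
    c (stem q `|` D) = i].
  have [ci|ci] := eqVneq (c (stem q `|` D0)) i; first by exists D0; split.
  have D0E : e |` D0 `\ e = D0 by exact: setD1K.
  exists (D0 `\ e); split; first by move=> b [].
    move=> fD; apply: inf; rewrite -[X in finite_set X]/D0.
    by rewrite -D0E finite_setU; split.
  have nqe : ~ stem q e.
    by move=> /qa; rewrite ltNge aq//; case: D0e.
  have nDe : ~ (stem q `|` D0 `\ e) e by case=> [//|[_ ne]]; apply: ne.
  have cE : c (stem q `|` D0) = ~~ c (stem q `|` D0 `\ e).
    by rewrite -(cflip nDe) setUCA D0E.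
  move: ci; rewrite cE.
  by case: (c _) i => -[].
have adl : a < dl by case: D0e => /aq /= + ; apply: le_lt_trans.
have [B AAB BA] := trim dl (reservoirP q).
have [||q' [q's q'B] tq'] := @tight_cond (stem q `|` D) B dl AAB.
- by move=> b [/qa ba|/DD0[]//]; apply: lt_trans ba adl.
- by move=> b /BA[].
exists q', dl; split=> //.
  apply/mathias_leP; rewrite q's q'B; split; first by move=> b; left.
    by move=> b /BA[].
  by move=> b [[//|/DD0[]]].
(* The reservoir was trimmed to start at [dl], so everything below [dl] is frozen. *)
have xE x e' : body q' x -> e' < dl -> x e' <-> (stem q `|` D) e'.
  move=> [qx xq] edl; split; last by rewrite -q's => /qx.
  move=> /xq; rewrite q's q'B => -[//|/BA[_ /=]].
  by rewrite leNgt edl.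
move=> x bx; exists dl; split=> //.
- apply: sub_infinite_set infD => b Db.
  have [rb bdl] := DD0 _ Db; split; first by apply/xE => //; right.
  by rewrite aq.
- move=> g gdl; apply: sub_finite_set (fin _ gdl) => b [xb /andP[ab bg]].
  split=> //; have := xb; rewrite xE//; last exact: lt_trans bg gdl.
  by case=> [/qa|/DD0[]//]; rewrite ltNge ab.
- rewrite -cD; congr c; apply/seteqP; split=> b /=.
    by case=> xb bdl; apply/(xE x).
  move=> qDb; suff bdl : b < dl by split=> //; apply/xE.
  by case: qDb => [/qa ba|/DD0[]//]; apply: lt_trans ba adl.
Qed.

(** The colour at [a] is fixed before [Y] is avoided, since avoiding [Y] may add uncontrolled
    elements above [a]; strengthening preserves a colour already decided. *)
Lemma successor_step (q : P) (a e : K) (Y : set (kseq K bool)) (i : bool) :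
  tight q a -> nowhere_dense le tree Y ->
  exists q' b, [/\ le q' q, a < b, e <= b, tight q' b &
    body q' `<=` [set x | colour_at c x a b i /\ ~ Y x]].
Proof.
move=> tq ndY.
have [q1 [b1 [q1q ab1 tq1 col]]] := extend_colour i tq.
have [q2 q2q1 q2Y] := ndY q1.
have [b2 q2b2] := stem_bounded q2.
have [|q3 q3q2 tq3] := @tighten q2 (Order.max b2 (Order.max b1 e)).
  by move=> b /q2b2 bb2; rewrite lt_max bb2.
exists q3, (Order.max b2 (Order.max b1 e)); split=> //.
- by apply: mathias_le_trans q3q2 _; apply: mathias_le_trans q2q1 _.
- by rewrite !lt_max ab1 orbT.
- by rewrite !le_max lexx !orbT.
move=> x /(body_le q3q2) q2x; split; last by apply: q2Y; apply: body_branches.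
have [dl [dlb1 inf fin cx]] := col _ (body_le q2q1 q2x).
by exists dl; split=> //; rewrite !le_max dlb1 !orbT.
Qed.

(** This covers every stage [a], not only limits. The minimality of [b'] will give continuity of the
    club enumeration. *)
Lemma limit_step (q0 : P) (a0 a : K) (q : K -> P) (b : K -> K) :
  tight q0 a0 ->
  (forall e, e < a -> [/\ le (q e) q0, a0 <= b e & tight (q e) (b e)]) ->
  (forall e f, e < f -> f < a -> le (q f) (q e)) ->
  exists q' b',
    [/\ [/\ le q' q0, forall e, e < a -> le q' (q e) & tight q' b'],
    a0 <= b', forall e, e < a -> b e <= b' &
    forall g, a0 <= g -> (forall e, e < a -> b e <= g) -> b' <= g].
Proof.
move=> tq0 qq0 qdec.
have [[e0 e0a]|noe] := pselect (exists e, e < a); last first.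
  by exists q0, a0; do !split=> //; [exact: mathias_le_refl|..] => e ea;
    case: noe; exists e.
have [r rq] := AAclosed qdec.
have [|b' b'ub b'min] := @wo_lub _ _ Kcard.1 (b @` [set e | e < a]).
  have [g bg] := image_below_bounded Kcard Kreg b a.
  by exists g => _ [e ea <-]; apply/ltW/bg.
have b'b e : e < a -> b e <= b' by move=> ea; apply: b'ub; exists e.
have [||q' [q's q'r] tq'] :=
  @tight_cond (stem r `&` [set e | e < b']) (reservoir r) b' (reservoirP r).
- by move=> e [].
(* The reservoir of [r] lies in each earlier one, hence above every [b f], hence from their supremum
   [b'] on. *)
- move=> e re; apply: b'min => _ [f fa <-].
  have /mathias_leP[_ /(_ _ re) + _] := rq _ fa.
  by have [_ _ [_]] := qq0 _ fa; apply.
have q'q e : e < a -> le q' (q e).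
  move=> ea; have /mathias_leP[sub res ext] := rq _ ea.
  apply/mathias_leP; rewrite q's q'r; split=> //.
    move=> f qf; split; first exact: sub.
    have [_ _ [/(_ _ qf) fb _]] := qq0 _ ea.
    exact: lt_le_trans fb (b'b _ ea).
  by move=> f [[rf _] nqf]; apply: ext.
have [q00 a00 _] := qq0 _ e0a.
exists q', b'; split=> //.
- by split=> //; apply: mathias_le_trans (q'q _ e0a) q00.
- exact: le_trans a00 (b'b _ e0a).
- by move=> g _ bg; apply: b'min => _ [e ea <-]; apply: bg.
Qed.

Lemma coloured_branch (q0 : P) (Y : K -> set (kseq K bool)) (i : bool) :
  (forall a, nowhere_dense le tree (Y a)) ->
  exists x, [/\ branches (tree q0) x, coloured c i x & forall a, ~ Y a x].
Proof.
move=> ndY.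
have [a0 q0a0] := stem_bounded q0.
have [q1 q1q0 tq1] := tighten q0a0.
(* In a stage [(q', h, b)], [h] is the supremum of [a0] and of the third
   components of the earlier stages, so [h] is a normal function of the stage. *)
pose R a (g : K -> P * K * K) (z : P * K * K) : Prop :=
  let: (q', h, b) := z in
  [/\ [/\ le q' q1, forall e, e < a -> le q' (g e).1.1 & tight q' b],
      [/\ a0 <= h, h < b & forall e, e < a -> (g e).2 <= h],
      forall f, a0 <= f -> (forall e, e < a -> (g e).2 <= f) -> h <= f &
      body q' `<=` [set x | colour_at c x h b i /\ ~ Y a x]].
have [||g gR] := @transfinite_choice _ K Kcard.1 _ R (q1, a0, a0).
- move=> a g g' [[q' h] b] gg' [[qq1 qg tq] [a0h hb gh] hmin bq].
  split=> //; first by split=> // e ea; rewrite -gg'//; apply: qg.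
    by split=> // e ea; rewrite -gg'//; apply: gh.
  move=> f a0f gf; apply: hmin => // e ea; rewrite gg'//; exact: gf.
- move=> a g gR.
  have [|||q [h [[qq1 qg tq] a0h gh hmin]]] :=
      @limit_step q1 a0 a (fun e => (g e).1.1) (fun e => (g e).2).
  + exact: tq1.
  + move=> e /gR; rewrite /R; case: (g e) => [[q' h] b] /=.
    move=> [[? _ ?] [? hb _] _ _].
    by split=> //; apply: le_trans (ltW hb).
  + move=> e f ef /gR; rewrite /R; case: (g f) => [[q' h] b] /=.
    move=> [[_ qg _] _ _ _].
    exact: qg.
  have [q' [b [q'q hb _ tq' bq']]] := successor_step h i tq (ndY a).
  exists (q', h, b); split=> //; split=> //.
    exact: mathias_le_trans q'q qq1.
  by move=> e ea; apply: mathias_le_trans q'q (qg _ ea).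
pose q a := (g a).1.1; pose h a := (g a).1.2; pose b a := (g a).2.
have gP a : [/\ [/\ le (q a) q1, forall e, e < a -> le (q a) (q e) &
        tight (q a) (b a)],
      [/\ a0 <= h a, h a < b a & forall e, e < a -> b e <= h a],
      forall f, a0 <= f -> (forall e, e < a -> b e <= f) -> h a <= f &
      body (q a) `<=` [set x | colour_at c x (h a) (b a) i /\ ~ Y a x]].
  by have := gR a; rewrite /R /q /h /b; case: (g a) => [[]].
(* The union of the stems lies in every [body (q a)]: later stems add only elements of the reservoir
   of [q a]. *)
pose x : kseq K bool := fun e => `[< exists a, stem (q a) e >].
have bx a : body (q a) x.
  split=> e; first by move=> qe; apply/asboolP; exists a.
  move=> /asboolP[f qfe]; case: (ltgtP f a) => [fa|af|<-]; last by left.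
    left; have [[_ /(_ _ fa) + _] _ _ _] := gP a.
    by move=> /mathias_leP[+ _ _]; apply.
  have [[_ /(_ _ af) + _] _ _ _] := gP f.
  move=> /mathias_leP[_ _ ext].
  by have [|nqe] := pselect (stem (q a) e); [left|right; apply: ext].
have colx a : colour_at c x (h a) (b a) i /\ ~ Y a x.
  by have [_ _ _] := gP a; apply.
exists x; split; last by move=> a; have [] := colx a.
  apply: body_branches; apply: (body_le q1q0).
  (* Any stage would do here; [a0] is merely an available index. *)
  by have [[qq1 _ _] _ _ _] := gP a0; apply: (body_le qq1).
have bh e a : e < a -> b e <= h a by have [_ [_ _ +] _ _] := gP a; apply.
exists h; split; last first.
  move=> e a ea; have [[dl [dlb ? ? ?]] _] := colx e.
  by exists dl; split=> //; apply: le_trans (bh _ _ ea).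
split=> [e a ea|l [[e0 e0l] lim] a ahl].
  by have [_ [_ hb _] _ _] := gP e; apply: lt_le_trans hb (bh _ _ ea).
apply: contrapT => /forall2NP nb.
(* If [a] bounded all [h e] with [e < l], it would bound all [b e], because [b e <= h f] for some
   [f] between [e] and [l]; minimality then gives [h l <= a]. *)
have hbnd e : e < l -> h e <= a.
  by move=> el; rewrite leNgt; apply/negP; case: (nb e).
suff : h l <= a by rewrite leNgt ahl.
have [_ _ hmin _] := gP l; apply: hmin.
  by have [_ [a0h _ _] _ _] := gP e0; apply: le_trans a0h (hbnd _ e0l).
move=> e /lim[f ef fl]; exact: le_trans (bh _ _ ef) (hbnd _ fl).
Qed.

End Colouring.

End Mathias.

(** * Failure of measurability *)

Lemma meager_enum d (K : orderType d) (P : Type) (le : P -> P -> Prop)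
    (tree : P -> set (short_seq K bool)) (X : set (kseq K bool)) :
  (forall p, le p p) -> meager le tree X ->
  exists2 Y : K -> set (kseq K bool), forall a, nowhere_dense le tree (Y a) &
    X `<=` \bigcup_a Y a.
Proof.
move=> lexx [N [/card_leP[f] Nnd XN]].
(* Indices outside the range of the injection get the empty set, which is nowhere dense by
   reflexivity of [le]. *)
exists (fun a => if pselect (exists n, val (f n) = a) is left e
                 then val (sval (cid e)) else set0) => [a|x /XN[Z NZ Zx]].
  case: pselect => [e|_ p]; last by exists p => // x _ [].
  by apply/Nnd/set_mem/valP.
exists (val (f (SigSub (mem_set NZ)))) => //.
case: pselect => [e|[]]; last by exists (SigSub (mem_set NZ)).
case: cid => n /= /val_inj/(inj (in_setT _) (in_setT _)) ->.
by rewrite SubK.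
Qed.

Theorem corollary32 (d : Order.disp_t) (K : orderType d) (AA : set (set K)) :
  is_cardinal K -> is_uncountable K -> is_regular K ->
  kappa_lt_kappa_eq_kappa K ->
  mathias_version AA ->
  lt_kappa_closed K (@mathias_le d K AA) ->
  has_fusion K (@mathias_le d K AA) ->
  exists2 X : set (kseq K bool), Sigma11 X &
    ~ tree_measurable (@mathias_le d K AA) (@mathias_tree d K AA) X.
Proof.
move=> Kcard Kunc Kreg _ AAv AAclosed _.
have [c cflip] := exists_flipping K.
exists (coloured c true).
  by apply: Sigma11_coloured; apply: exists_gt.
have col0 x : coloured c false x -> ~ coloured c true x.
  move=> [h [nh colh]] [h' [nh' colh']].
  have [l hl] := normal_common_value Kcard Kunc Kreg nh nh'.
  have [l' ll'] := exists_gt Kunc Kreg l.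
  have := colh' _ _ ll'; rewrite -hl => /colour_at_unique/(_ (colh _ _ ll')).
  by [].
have [[A AAA] _ _] := AAv.
have [q0 _] : exists q : mathias AA, True.
  have c0 : mathias_cond AA (set0, A).
    by split=> //= /card_le_trans/(_ (countable0 K)).
  by exists (exist _ _ c0).
(* A branch of colour [true] escapes a meager cover of the part inside the set, one of colour
   [false] a cover of the part outside. *)
move=> /(_ q0)[q _ [] /(meager_enum (@mathias_le_refl _ _ AA))[Y ndY qY]].
  have [x [qx cx nYx]] :=
    coloured_branch Kcard Kunc Kreg AAv AAclosed cflip q true ndY.
  by have [a _ /nYx] := qY x (conj qx cx).
have [x [qx /col0 cx nYx]] :=
  coloured_branch Kcard Kunc Kreg AAv AAclosed cflip q false ndY.
by have [a _ /nYx] := qY x (conj qx cx).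
Qed.
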